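(* Consider the third-order Lyness recurrences $$x_{n+3}=\frac{a+x_{n+1}+x_{n+2}}{x_n},\qquad a\in\mathbb{C}.$$ The only globally periodic one corresponds to $a=1$, and it is globally $8$-periodic.
   Context: A recurrence is globally $p$-periodic if for all (complex) initial conditions for which the sequence $\{x_n\}$ is well defined, the sequence is $p$-periodic ($x_{n+p}=x_n$ for all $n$), and $p$ is the smallest positive integer with this property. It is globally periodic if it is globally $p$-periodic for some $p$. *)

(* Defs.v *)
From mathcomp Require Import all_boot all_order all_algebra.
From mathcomp Require Import complex.
From mathcomp Require Import reals.
Set Implicit Arguments.
Unset Strict Implicit.
Unset Printing Implicit Defensive.
Import Order.TTheory GRing.Theory Num.Theory.
Local Open Scope ring_scope.

(* A recurrence is represented by the set S of the sequences it generates from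
   those initial conditions for which every term is well defined. *)

Definition all_periodic (T : Type) (S : (nat -> T) -> Prop) (p : nat) : Prop :=
  forall x : nat -> T, S x -> forall n : nat, x (n + p)%N = x n.

Definition globally_periodic_of_period (T : Type) (S : (nat -> T) -> Prop)
    (p : nat) : Prop :=
  [/\ (0 < p)%N, all_periodic S p
    & forall q : nat, (0 < q)%N -> all_periodic S q -> (p <= q)%N].

Definition globally_periodic (T : Type) (S : (nat -> T) -> Prop) : Prop :=
  exists p : nat, globally_periodic_of_period S p.

(* Each x n with n >= 0 is the denominator of x n.+3, so the sequence issued
   from (x 0, x 1, x 2) is well defined exactly when no term vanishes; it is
   then determined by these three values. *)
Definition lyness3 (F : fieldType) (a : F) (x : nat -> F) : Prop :=
  forall n : nat, x n != 0 /\ x n.+3 = (a + x n.+1 + x n.+2) / x n.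

(* Main.v *)
(* For a <> 1, start from x0 = w, x1 = c (1 + w), x2 = t and let t tend to 0. The
   terms x5, x6, x7 have simple poles at t = 0, but the singularity is confined:
   x8 tends to mu w, x9 to c (1 + mu w), and x10 is of exact order t, where
   mu = (1 + c) / (a + c). If every orbit had period p, then x_{8p} = x0 for all
   but countably many t; letting t tend to 0 gives mu^p = 1. As a <> 1, c can be
   chosen so that mu is 2 or 3. *)
Require Import Defs.
From mathcomp Require Import all_boot all_order all_algebra.
From mathcomp Require Import complex.
From mathcomp Require Import reals.
From mathcomp Require Import ring.
From mathcomp Require Import boolp classical_sets cardinality.
From mathcomp Require Import constructive_ereal measure lebesgue_measure.
Set Implicit Arguments.
Unset Strict Implicit.
Unset Printing Implicit Defensive.
Import Order.TTheory GRing.Theory Num.Theory.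
Local Open Scope ring_scope.

(** * Avoiding countably many finite sets of complex numbers *)

Lemma real_setT_uncountable (R : realType) : ~ countable [set: R]%classic.
Proof.
(* Countable sets are Lebesgue-null, but the unit interval has measure 1. *)
move=> cR; have := countable_lebesgue_measure0 cR.
have sub : ([set` `[0%R, 1%R]] `<=` [set: R])%classic by [].
move=> R0; have : (lebesgue_measure [set` `[0%R, 1%R : R]] <= 0)%E.
  by rewrite -R0 le_measure ?inE.
by rewrite lebesgue_measure_itv /= lte_fin ltr01 sube0 lee_fin ler10.
Qed.

(** A real [z] can be found: each [B n] meets the real line in a finite set, and countably many
    finite sets do not cover an uncountable line. *)
Lemma complex_avoid_finite_sets (R : realType) (B : nat -> set R[i]) :
  (forall n, finite_set (B n)) -> exists z, forall n, ~ B n z.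
Proof.
move=> Bfin; apply: contrapT => /forallNP noz.
apply: (@real_setT_uncountable R).
have -> : [set: R]%classic = (\bigcup_(n in setT) (real_complex R @^-1` B n))%classic.
  apply/seteqP; split=> // r _.
  by have /existsNP[n /contrapT Bn] := noz (real_complex R r); exists n.
apply: bigcup_countable => // n _; apply: finite_set_countable.
by apply: finite_preimage (Bfin n) => x y _ _ [].
Qed.

(** * Values at 0 of rational functions *)

Section RegularAtZero.
Variable F : fieldType.
Implicit Types (f g : F -> F) (c d : F).

(* [f] agrees, off finitely many points and off 0, with a rational function
   whose value at 0 is [c]; the point 0 is excluded because the sequences to
   which this applies take junk values (divisions by zero) there. *)
Definition regular0 f c : Prop :=
  exists P Q : {poly F}, [/\ Q.[0] != 0, P.[0] = c * Q.[0]
    & forall t, t != 0 -> Q.[t] != 0 -> f t = P.[t] / Q.[t]].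

Lemma regular0_ext f g c :
  (forall t, t != 0 -> f t = g t) -> regular0 f c -> regular0 g c.
Proof.
by move=> fg [P [Q [Q0 Pc fE]]]; exists P, Q; split=> // t t0 /(fE t t0) <-; rewrite fg.
Qed.

Lemma regular0_cst c : regular0 (fun=> c) c.
Proof.
exists c%:P, 1; split; rewrite ?hornerE ?oner_neq0 // => t _ _.
by rewrite !hornerE divr1.
Qed.

Lemma regular0_id : regular0 id 0.
Proof.
exists 'X, 1; split; rewrite ?hornerE ?oner_neq0 ?mul0r // => t _ _.
by rewrite !hornerE divr1.
Qed.

Lemma regular0D f g c d :
  regular0 f c -> regular0 g d -> regular0 (fun t => f t + g t) (c + d).
Proof.
move=> [P [Q [Q0 Pc fE]]] [P' [Q' [Q'0 Pd gE]]].
exists (P * Q' + P' * Q), (Q * Q'); split.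
- by rewrite hornerM mulf_neq0.
- by rewrite !(hornerD, hornerM) Pc Pd; ring.
- move=> t t0; rewrite hornerM mulf_eq0 negb_or => /andP[Qt Q't].
  rewrite fE // gE // !(hornerD, hornerM); field; exact/andP.
Qed.

Lemma regular0M f g c d :
  regular0 f c -> regular0 g d -> regular0 (fun t => f t * g t) (c * d).
Proof.
move=> [P [Q [Q0 Pc fE]]] [P' [Q' [Q'0 Pd gE]]].
exists (P * P'), (Q * Q'); split.
- by rewrite hornerM mulf_neq0.
- by rewrite !(hornerD, hornerM) Pc Pd; ring.
- move=> t t0; rewrite hornerM mulf_eq0 negb_or => /andP[Qt Q't].
  rewrite fE // gE // !(hornerD, hornerM); field; exact/andP.
Qed.

Lemma regular0V f c : c != 0 -> regular0 f c -> regular0 (fun t => (f t)^-1) c^-1.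
Proof.
(* The fraction is left unreduced so that a nonzero denominator also gives [Q.[t] != 0], which [fE]
   requires. *)
move=> c0 [P [Q [Q0 Pc fE]]]; exists (Q * Q), (P * Q); split.
- by rewrite hornerM Pc !mulf_neq0.
- by rewrite !hornerM Pc mulrA mulKf.
- move=> t t0; rewrite hornerM mulf_eq0 negb_or => /andP[Pt Qt].
  rewrite fE // !hornerM; field; exact/andP.
Qed.

Lemma regular0_div f g c d : d != 0 ->
  regular0 f c -> regular0 g d -> regular0 (fun t => f t / g t) (c / d).
Proof. by move=> d0 rf rg; apply: regular0M rf (regular0V d0 rg). Qed.

Lemma poly_finite_roots (p : {poly F}) :
  p != 0 -> exists s : seq F, forall t, root p t -> t \in s.
Proof.
elim: {p}(size p) {-2}p (leqnn (size p)) => [|n IHn] p.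
  by rewrite leqn0 size_poly_eq0 => /eqP->; rewrite eqxx.
move=> szp pn0; have [[t rt]|nor] := pselect (exists t, root p t); last first.
  by exists [::] => t rt; case: nor; exists t.
have /factor_theorem[q pE] := rt.
have qn0 : q != 0 by apply: contra_neq pn0; rewrite pE => ->; rewrite mul0r.
have [|s sE] := IHn q _ qn0.
  by move: szp; rewrite pE size_Mmonic ?monicXsubC // size_XsubC addn2.
exists (t :: s) => u; rewrite pE rootM root_XsubC inE => /orP[/sE ->|->] //.
by rewrite orbT.
Qed.

Lemma regular0_finite_zeros f c :
  c != 0 -> regular0 f c -> finite_set [set t | f t = 0].
Proof.
(* The factor ['X] covers the excluded point 0, and [Q] the points where [fE] says nothing; every
   zero of [f] is then a root of [p]. *)
move=> c0 [P [Q [Q0 Pc fE]]]; pose p := 'X * (P * Q).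
have pn0 : p != 0.
  rewrite !mulf_neq0 ?polyX_eq0 //.
    by apply: contra_neq (mulf_neq0 c0 Q0) => P0; rewrite -Pc P0 horner0.
  by apply: contra_neq Q0 => ->; rewrite horner0.
have [s sE] := poly_finite_roots pn0.
apply: (@sub_finite_set _ _ [set` s]); last exact: finite_seq.
move=> t /= ft0; apply: sE; rewrite !rootM rootX; apply: contraT.
rewrite !negb_or => /and3P[t0 Pt Qt]; move/eqP: ft0; rewrite fE // mulf_eq0 invr_eq0.
by rewrite -![_ == 0]/(root _ t) (negbTE Pt) (negbTE Qt).
Qed.

Lemma regular0_pole_finite_zeros f c :
  c != 0 -> regular0 (fun t => t * f t) c -> finite_set [set t | f t = 0].
Proof.
move=> c0 /(regular0_finite_zeros c0); apply: sub_finite_set => t /= ->.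
by rewrite mulr0.
Qed.

End RegularAtZero.

(** * Orbits issued from an initial triple *)

Section LynessOrbit.
Variables (F : fieldType) (a : F).

Definition lyness_step (s : F * F * F) : F * F * F :=
  (s.1.2, s.2, (a + s.1.2 + s.2) / s.1.1).

Definition lyness_orbit (x y z : F) (n : nat) : F :=
  (iter n lyness_step (x, y, z)).1.1.

(** Division is total, so this holds even past a vanishing term. *)
Lemma lyness_orbit_rec x y z n :
  lyness_orbit x y z n.+3 =
  (a + lyness_orbit x y z n.+1 + lyness_orbit x y z n.+2) / lyness_orbit x y z n.
Proof. by rewrite /lyness_orbit !iterS /=. Qed.

Lemma lyness3_orbit x y z :
  (forall n, lyness_orbit x y z n != 0) -> lyness3 a (lyness_orbit x y z).
Proof. by move=> x0 n; split=> //; apply: lyness_orbit_rec. Qed.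

End LynessOrbit.

(** * Confinement of the singularity over eight steps *)

Section Degeneration.
Variables (F : fieldType) (a c : F).

(* The values of [w] at which [x0], [x1], [x3] or the leading coefficient of [x5]
   or [x7] in [t] vanishes. *)
Definition degenerate_values : seq F :=
  [:: 0; - 1; - ((a + c) / c); - ((1 + c) / c); - ((a + c) / (1 + c))].

Let mu := (1 + c) / (a + c).

Hypotheses (c0 : c != 0) (c1 : 1 + c != 0) (ac : a + c != 0).

(* Along the curve [x1 = c * (1 + x0)] of the exceptional plane [x2 = 0], eight
   steps of the recurrence confine the singularity ([x5], [x6], [x7] have simple
   poles in [t]) and act by [x0 |-> mu * x0]. *)
Lemma lyness_eight_steps (f : nat -> F -> F) (w e : F) :
  (forall n t, f n.+3 t = (a + f n.+1 t + f n.+2 t) / f n t) ->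
  w \notin degenerate_values -> mu * w \notin degenerate_values -> e != 0 ->
  regular0 (f 0%N) w -> regular0 (f 1%N) (c * (1 + w)) ->
  regular0 (fun t => f 2 t / t) e ->
  [/\ regular0 (f 8) (mu * w), regular0 (f 9) (c * (1 + mu * w)),
      exists2 e', e' != 0 & regular0 (fun t => f 10 t / t) e'
    & forall i, (i < 8)%N -> finite_set [set t | f i t = 0]].
Proof.
move=> frec; rewrite !inE !negb_or => /and5P[w0 w1 w2 w3 w4].
move=> /and5P[_ _ _ _ muw4] e0 r0 r1 r2e.
have w1' : 1 + w != 0 by rewrite addrC -[1]opprK subr_eq0.
have w2' : a + c + c * w != 0.
  by apply: contra_neq w2 => h; apply: (mulfI c0); rewrite -[RHS]addr0 -h; field.
have w3' : 1 + c + c * w != 0.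
  by apply: contra_neq w3 => h; apply: (mulfI c0); rewrite -[RHS]addr0 -h; field.
have w4' : a + c + (1 + c) * w != 0.
  by apply: contra_neq w4 => h; apply: (mulfI c1); rewrite -[RHS]addr0 -h; field.
have rC := @regular0_cst F; have rt := @regular0_id F.
have r2 : regular0 (f 2) 0.
  have := regular0M rt r2e; rewrite mul0r; apply: regular0_ext => t t0.
  by rewrite mulrC divfK.
pose u := (a + c + c * w) / w.
have u0 : u != 0 by rewrite mulf_neq0 ?invr_eq0.
have r3 : regular0 (f 3) u.
  have := regular0_div w0 (regular0D (regular0D (rC a) r1) r2) r0.
  have -> : (a + c * (1 + w) + 0) / w = u by rewrite /u; congr (_ / _); ring.
  by apply: regular0_ext => t _; rewrite (frec 0%N).
(* Since [x1] tends to [c * (1 + w)], [a + x3] tends to [(a + c) * (1 + w) / w], and the factor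
   [1 + w] cancels in the limit of [x4]. *)
pose v := (a + c) / (c * w).
have v0 : v != 0 by rewrite mulf_neq0 ?invr_eq0 ?mulf_neq0.
have y0 : c * (1 + w) != 0 by rewrite mulf_neq0.
have r4 : regular0 (f 4) v.
  have := regular0_div y0 (regular0D (regular0D (rC a) r2) r3) r1.
  have -> : (a + 0 + u) / (c * (1 + w)) = v.
    by rewrite /u /v; field; rewrite c0 w0 w1'.
  by apply: regular0_ext => t _; rewrite (frec 1%N).
(* [A] is [a + u + v], the limit of the numerator of [x5]; its denominator [x2] behaves like
   [e * t]. *)
pose A := (a + c) * (1 + c + c * w) / (c * w).
have A0 : A != 0 by rewrite !mulf_neq0 ?invr_eq0 ?mulf_neq0.
have r5 : regular0 (fun t => t * f 5 t) (A / e).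
  have := regular0_div e0 (regular0D (regular0D (rC a) r3) r4) r2e.
  have -> : (a + u + v) / e = A / e.
    by rewrite /u /v /A; field; rewrite c0 w0 e0.
  by apply: regular0_ext => t _; rewrite (frec 2) invfM invrK [t * _]mulrC mulrA.
have A5 : A / e != 0 by rewrite mulf_neq0 ?invr_eq0.
have r6 : regular0 (fun t => t * f 6 t) (A / e / u).
  have := regular0_div u0 (regular0D (regular0M rt (regular0D (rC a) r4)) r5) r3.
  rewrite mul0r add0r; apply: regular0_ext => t _.
  by rewrite (frec 3) mulrA !mulrDr.
have A6 : A / e / u != 0 by rewrite mulf_neq0 ?invr_eq0.
(* [B] is [1 + u]: the residues of [x5] and [x6] add up to [A / e * B / u]. *)
pose B := (a + c + (1 + c) * w) / w.
have B0 : B != 0 by rewrite mulf_neq0 ?invr_eq0.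
have r7 : regular0 (fun t => t * f 7 t) (A / e * B / (u * v)).
  have := regular0_div v0 (regular0D (regular0D (regular0M rt (rC a)) r5) r6) r4.
  have -> : (0 * a + A / e + A / e / u) / v = A / e * B / (u * v).
    by rewrite /B /u; field; rewrite w0 v0 w2' e0.
  by apply: regular0_ext => t _; rewrite (frec 4) mulrA !mulrDr.
have A7 : A / e * B / (u * v) != 0 by rewrite !(mulf_neq0, invr_eq0).
(* For [x8] and [x9], numerator and denominator are both multiplied by [t], which leaves a quotient
   of residues. *)
have r8 : regular0 (f 8) (mu * w).
  have := regular0_div A5 (regular0D (regular0D (regular0M rt (rC a)) r6) r7) r5.
  have -> : (0 * a + A / e / u + A / e * B / (u * v)) / (A / e) = mu * w.
    rewrite /mu /B /u /v /A; field; by rewrite ?c0 ?w0 ?e0 ?ac ?w2' ?w3'.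
  apply: regular0_ext => t t0; rewrite (frec 5) -!mulrDr.
  by rewrite invfM mulrACA divff // mul1r.
have r9 : regular0 (f 9) (c * (1 + mu * w)).
  have := regular0_div A6
    (regular0D (regular0M rt (regular0D (rC a) r8)) r7) r6.
  have -> : (0 * (a + mu * w) + A / e * B / (u * v)) / (A / e / u)
      = c * (1 + mu * w).
    rewrite /mu /B /u /v /A; field; by rewrite ?c0 ?w0 ?e0 ?ac ?w2' ?w3'.
  apply: regular0_ext => t t0; rewrite (frec 6) [a + f 7 t + _]addrAC -mulrDr.
  by rewrite invfM mulrACA divff // mul1r.
(* [C], the limit of the numerator of [x10], equals [a + c + (1 + c) * (mu * w)]; it is nonzero
   because [mu * w] avoids the last degenerate value. *)
pose C := a + mu * w + c * (1 + mu * w).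
have C0 : C != 0.
  apply: contra_neq muw4 => C0; apply: (mulfI c1); rewrite -[RHS]addr0 -C0 /C.
  by field; rewrite c1.
split=> //.
  exists (C / (A / e * B / (u * v))); first by rewrite mulf_neq0 ?invr_eq0.
  have := regular0_div A7 (regular0D (regular0D (rC a) r8) r9) r7.
  by apply: regular0_ext => t _; rewrite (frec 7) invfM mulrA mulrAC.
have fz := @regular0_finite_zeros F; have fp := @regular0_pole_finite_zeros F.
case=> [|[|[|[|[|[|[|[|//]]]]]]]] _.
- exact: fz r0.
- exact: fz r1.
- by apply: sub_finite_set (fz _ _ e0 r2e) => t /= ->; rewrite mul0r.
- exact: fz r3.
- exact: fz r4.
- exact: fp r5.
- exact: fp r6.
- exact: fp r7.
Qed.
End Degeneration.

(** * Non-periodicity when [a] differs from 1 *)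

Section NonPeriodicity.
Variable R : realType.

Lemma periodic_multiple (T : Type) (x : nat -> T) (p k : nat) :
  (forall n, x (n + p)%N = x n) -> x (k * p)%N = x 0%N.
Proof. by move=> xp; elim: k => // k IHk; rewrite mulSn addnC xp. Qed.

Lemma lyness_not_periodic (a mu : R[i]) (p : nat) :
  mu != 0 -> (forall k, (0 < k)%N -> mu ^+ k != 1) -> mu * a != 1 -> a != 1 ->
  (0 < p)%N -> ~ all_periodic (lyness3 a) p.
Proof.
move=> mu0 muk mua a1 p0 per.
have mu1 : mu - 1 != 0 by rewrite subr_eq0 (muk 1%N).
have a1' : 1 - a != 0 by rewrite subr_eq0 eq_sym.
(* The solution of [1 + c = mu * (a + c)]. *)
pose c := (1 - mu * a) / (mu - 1).
have acE : a + c = (1 - a) / (mu - 1) by rewrite /c; field.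
have c1E : 1 + c = mu * (1 - a) / (mu - 1) by rewrite /c; field.
have c0 : c != 0 by rewrite mulf_neq0 ?invr_eq0 // subr_eq0 eq_sym.
have ac : a + c != 0 by rewrite acE mulf_neq0 ?invr_eq0.
have c1 : 1 + c != 0 by rewrite c1E !mulf_neq0 ?invr_eq0.
have muE : (1 + c) / (a + c) = mu.
  by rewrite acE c1E; field; rewrite mu1 a1'.
(* Multiplication by [mu ^+ k] is injective, so each [k] rules out only finitely many [w]. *)
have [w wgood] : exists w, forall k, mu ^+ k * w \notin degenerate_values a c.
  have [|w wP] := @complex_avoid_finite_sets R
      (fun k => [set w | mu ^+ k * w \in degenerate_values a c]%classic).
    move=> k; apply: (@finite_preimage _ _ [set` degenerate_values a c]).
      by move=> x y _ _; apply: mulfI; rewrite expf_neq0.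
    exact: finite_seq.
  by exists w => k; apply/negP/wP.
pose f n t := lyness_orbit a w (c * (1 + w)) t n.
have frec n t : f n.+3 t = (a + f n.+1 t + f n.+2 t) / f n t.
  exact: lyness_orbit_rec.
have block k : [/\ regular0 (f (k * 8)%N) (mu ^+ k * w),
    regular0 (f (k * 8).+1) (c * (1 + mu ^+ k * w))
    & exists2 e, e != 0 & regular0 (fun t => f (k * 8).+2 t / t) e].
  elim: k => [|k [r0 r1 [e e0 r2]]].
    rewrite expr0 mul1r; split; try exact: regular0_cst.
    exists 1; rewrite ?oner_neq0 //; apply: regular0_ext (regular0_cst 1) => t t0.
    by rewrite /f /= divff.
  have := wgood k.+1; rewrite exprS -mulrA -{1}muE => wk1.
  have [] := @lyness_eight_steps _ a c c0 c1 ac (fun i => f (i + k * 8)%N)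
    (mu ^+ k * w) e _ (wgood k) wk1 e0 r0 r1 r2; first by move=> n t; apply: frec.
  by rewrite muE !mulSn.
have fz n : finite_set [set t | f n t = 0]%classic.
  have [r0 r1 [e e0 r2]] := block (n %/ 8)%N.
  have := wgood (n %/ 8)%N.+1; rewrite exprS -mulrA -{1}muE => wk1.
  have [_ _ _ /(_ (n %% 8)%N)] := @lyness_eight_steps _ a c c0 c1 ac
    (fun i => f (i + n %/ 8 * 8)%N)
    _ e (fun n t => frec _ t) (wgood (n %/ 8)%N) wk1 e0 r0 r1 r2.
  by rewrite addnC -divn_eq ltn_mod; apply.
(* The value at [t = 0] is [(mu ^+ p - 1) * w], and [w] is nonzero because 0 is a degenerate
   value. *)
have dz : finite_set [set t | f (p * 8)%N t - w = 0]%classic.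
  have [r0 _ _] := block p.
  have := regular0D r0 (regular0_cst (- w)); apply: regular0_finite_zeros.
  rewrite -[X in _ - X]mul1r -mulrBl mulf_neq0 ?subr_eq0 ?muk //.
  by have := wgood 0%N; rewrite expr0 mul1r inE negb_or => /andP[].
(* Index 0 carries the condition [x_{8p} <> x_0], index [m.+1] the condition [x_m <> 0]. *)
have [|t tP] := @complex_avoid_finite_sets R (fun n =>
    if n is m.+1 then [set t | f m t = 0]%classic
    else [set t | f (p * 8)%N t - w = 0]%classic).
  by case.
have xL : lyness3 a (f^~ t) by apply: lyness3_orbit => n; apply/eqP/(tP n.+1).
apply: (tP 0%N); rewrite /= mulnC (periodic_multiple 8 (per _ xL)).
by rewrite /f /= subrr.
Qed.

Lemma lyness_globally_periodic_eq1 (a : R[i]) :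
  globally_periodic (lyness3 a) -> a = 1.
Proof.
move=> [p [p0 per _]]; apply/eqP; apply: contraT => a1.
have natX (m k : nat) : (1 < m)%N -> (0 < k)%N -> (m%:R : R[i]) ^+ k != 1.
  by move=> m1 k0; rewrite -natrX pnatr_eq1 -(exp1n k) eqn_exp2r // gtn_eqF.
(* The multiplier 2 serves unless [2 * a = 1]; then 3 serves, since [2 * a = 3 * a = 1] would force
   [a = 0]. *)
have [a2|a2] := eqVneq (2%:R * a) 1.
- case: (@lyness_not_periodic a 3%:R p) => //; rewrite ?pnatr_eq0 //.
    by move=> k; apply: natX.
  apply: contra_neq a1 => a3; rewrite -[RHS]a3.
  have : 3%:R * a - 2%:R * a = 0 by rewrite a3 a2 subrr.
  rewrite -mulrBl -natrB // mul1r => a0.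
  by move: a3; rewrite a0 mulr0.
- case: (@lyness_not_periodic a 2%:R p) => //; rewrite ?pnatr_eq0 //.
  by move=> k; apply: natX.
Qed.

End NonPeriodicity.

(** * The case [a = 1]: period 8 and its minimality *)

Lemma lyness1_all_periodic (F : fieldType) : all_periodic (lyness3 (1 : F)) 8.
Proof.
move=> x xL n; rewrite addnC -[(8 + n)%N]/(n.+4.+4).
have nz k : x k != 0 by case: (xL k).
have fwd k : x k.+3 = (1 + x k.+1 + x k.+2) / x k by case: (xL k).
have bwd k : x k = (1 + x k.+1 + x k.+2) / x k.+3.
  apply: (mulIf (nz k.+3)); rewrite divfK //.
  by rewrite fwd mulrC divfK.
(* Solving forwards and backwards from the middle terms keeps the fractions small. *)
move: (nz n.+2) (nz n.+3) (nz n.+4) (nz n.+4.+1).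
rewrite (fwd n.+4.+1) (fwd n.+4) (fwd n.+3) (fwd n.+2) (bwd n) (bwd n.+1).
set p := x n.+2; set q := x n.+3; set r := x n.+4 => p0 q0 r0.
(* The nonvanishing of [x n.+4.+1] supplies the last denominator, [1 + q + r]. *)
rewrite mulf_eq0 negb_or => /andP[s0 _].
by field; rewrite p0 q0 r0 s0.
Qed.

(** The orbit of [(1, 2, 3)] for [a = 1]. Its initial value 1 occurs only once in the cycle, which
    excludes every period below 8. *)
Definition cycle8 (F : fieldType) : seq F :=
  [:: 1; 2; 3; 6; 5; 4; 5 / 3; 4 / 3].

Lemma lyness1_cycle8 (F : numFieldType) :
  lyness3 1 (fun n => (cycle8 F)`_(n %% 8)).
Proof.
have nat0 (m : nat) : (m.+1%:R : F) != 0 by rewrite pnatr_eq0.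
move=> n; have modD k : ((k + n) %% 8 = (k + n %% 8) %% 8)%N by rewrite modnDmr.
rewrite -[n.+1]/(1 + n)%N -[n.+2]/(2 + n)%N -[n.+3]/(3 + n)%N !modD.
have : (n %% 8 < 8)%N by rewrite ltn_mod.
case: (n %% 8)%N => [|[|[|[|[|[|[|[|//]]]]]]]] _ /=;
  by split; [rewrite ?mulf_neq0 ?invr_eq0 ?oner_neq0 | field; rewrite ?nat0].
Qed.

Lemma cycle8_eq1 (F : numFieldType) (q : nat) :
  (0 < q < 8)%N -> (cycle8 F)`_q != 1.
Proof.
have div3 (m : nat) : (m%:R / 3%:R == 1 :> F) = (m == 3).
  by rewrite -(inj_eq (mulIf (_ : 3%:R != 0))) ?divfK ?mul1r ?eqr_nat ?pnatr_eq0.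
by case: q => [|[|[|[|[|[|[|[|//]]]]]]]] //= _; rewrite ?div3 ?pnatr_eq1.
Qed.

Theorem proposition8 (R : realType) :
  (forall a : R[i], globally_periodic (lyness3 a) <-> a = 1)
  /\ globally_periodic_of_period (lyness3 (1 : R[i])) 8.
Proof.
have main : globally_periodic_of_period (lyness3 (1 : R[i])) 8.
  split=> //; first exact: lyness1_all_periodic.
  move=> q q0 per; rewrite leqNgt; apply/negP => q8.
  have /negP[] := @cycle8_eq1 R[i] q (introT andP (conj q0 q8)).
  by have := per _ (lyness1_cycle8 _) 0%N; rewrite add0n modn_small // => ->.
split=> // a; split; first exact: lyness_globally_periodic_eq1.
by move=> ->; exists 8.
Qed.
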